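(* For every integer $m\ge 3$, $$\hat{r}(2K_2,2P_m)=\min\{2m+1,\,3m-3\}=\begin{cases} 6, & m=3,\\ 2m+1, & m\ge 4.\end{cases}$$
   Context: All graphs are finite and simple. The size $e(F)$ of a graph $F$ is its number of edges. For graphs $F,G,H$, write $F\to(G,H)$ if for every coloring of the edges of $F$ with the colors red and blue, $F$ contains either a subgraph isomorphic to $G$ all of whose edges are red, or a subgraph isomorphic to $H$ all of whose edges are blue (subgraphs are not necessarily induced). The size Ramsey number $\hat{r}(G,H)$ is the smallest possible size of a graph $F$ with $F\to(G,H)$. $P_m$ denotes the path on $m$ vertices (with $m-1$ edges), $nP_m$ is the disjoint union of $n$ copies of $P_m$, and $2K_2$ is the disjoint union of two edges (a matching of size 2). *)

(* Defs.v *)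
From mathcomp Require Import all_boot.

Set Implicit Arguments.
Unset Strict Implicit.
Unset Printing Implicit Defensive.

Record sgraph := SGraph {
  vertex :> finType;
  adj : rel vertex;
  adj_sym : symmetric adj;
  adj_irrefl : irreflexive adj }.

Definition edges (F : sgraph) : {set {set F}} :=
  [set e : {set F} | [exists x, exists y, adj x y && (e == [set x; y])]].

Definition gsize (F : sgraph) : nat := #|edges F|.

(* The copy of G need not be induced: f need not reflect adjacency. *)
Definition contains_copy (F G : sgraph) : Prop :=
  exists f : G -> F, injective f /\ forall x y, adj x y -> adj (f x) (f y).

(* A coloring gives true (red) or false (blue) to each unordered pair of
   vertices; only its values on the edges of F matter. *)
Section ColorClass.
Variables (F : sgraph) (c : {set F} -> bool) (b : bool).

Definition color_adj : rel F := fun x y => adj x y && (c [set x; y] == b).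

Fact color_adj_sym : symmetric color_adj.
Proof. by move=> x y; rewrite /color_adj adj_sym setUC. Qed.

Fact color_adj_irrefl : irreflexive color_adj.
Proof. by move=> x; rewrite /color_adj adj_irrefl. Qed.

Definition color_class : sgraph := SGraph color_adj_sym color_adj_irrefl.
End ColorClass.

Definition arrows (F G H : sgraph) : Prop :=
  forall c : {set F} -> bool,
    contains_copy (color_class c true) G \/
    contains_copy (color_class c false) H.

Definition is_size_ramsey_number (G H : sgraph) (r : nat) : Prop :=
  (exists F : sgraph, arrows F G H /\ gsize F = r) /\
  (forall F : sgraph, arrows F G H -> r <= gsize F).

Section Complete.
Variable n : nat.

Definition complete_adj : rel 'I_n := fun x y => x != y.

Fact complete_adj_sym : symmetric complete_adj.
Proof. by move=> x y; rewrite /complete_adj eq_sym. Qed.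

Fact complete_adj_irrefl : irreflexive complete_adj.
Proof. by move=> x; rewrite /complete_adj eqxx. Qed.

Definition complete_graph : sgraph :=
  SGraph complete_adj_sym complete_adj_irrefl.
End Complete.

Section Path.
Variable m : nat.

Definition path_adj : rel 'I_m :=
  fun x y => (x.+1 == y :> nat) || (y.+1 == x :> nat).

Fact path_adj_sym : symmetric path_adj.
Proof. by move=> x y; rewrite /path_adj orbC. Qed.

Fact path_adj_irrefl : irreflexive path_adj.
Proof. by move=> x; rewrite /path_adj orbb gtn_eqF. Qed.

Definition path_graph : sgraph := SGraph path_adj_sym path_adj_irrefl.
End Path.

Section Copies.
Variables (n : nat) (G : sgraph).

Definition copies_adj : rel ('I_n * G)%type :=
  fun u v => (u.1 == v.1) && adj u.2 v.2.

Fact copies_adj_sym : symmetric copies_adj.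
Proof. by move=> u v; rewrite /copies_adj eq_sym adj_sym. Qed.

Fact copies_adj_irrefl : irreflexive copies_adj.
Proof. by move=> u; rewrite /copies_adj adj_irrefl andbF. Qed.

Definition copies : sgraph := SGraph copies_adj_sym copies_adj_irrefl.
End Copies.

(* Main.v *)
Require Import Defs.
From mathcomp Require Import all_boot.
From mathcomp Require Import zify.

(** If no two disjoint edges are red and [F] is triangle-free, then all red
    edges share a vertex; so a triangle-free [F] arrows [(2K_2, H)] as soon as
    [H] survives the deletion of any vertex.  This applies to [3P_3] and to the
    cycle on [2m+1] vertices.

    Conversely, let [F] arrow [(2K_2, 2P_m)]; colouring a star red shows that
    every [F - v] contains [2P_m].  Let [A], [B] be the paths of a copy of
    [2P_m], with second vertices [a] and [b].  As [a] has degree at least 2, [F]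
    has at least [2m] edges.  If there are exactly [2m], then [F - a] and [F - b]
    both have exactly the edges of a [2P_m], so every [P_m] in them is a whole
    nontrivial component.  Thus [B] is a component of [F - a]; when [m >= 4], the
    rest of [A] still has an edge in [F - a], so it meets the other component
    [C].  Now [A] and [C] are two components of [F - b] that meet, hence [A = C],
    although [a] is not in [C]. *)

Set Implicit Arguments.
Unset Strict Implicit.
Unset Printing Implicit Defensive.

(** * Edges as vertex pairs, and edge counts *)

Lemma set2_eqP (T : finType) (x y z t : T) :
  [set x; y] = [set z; t] -> (x = z /\ y = t) \/ (x = t /\ y = z).
Proof.
move=> E.
have xP : x \in [set z; t] by rewrite -E set21.
have yP : y \in [set z; t] by rewrite -E set22.
have zP : z \in [set x; y] by rewrite E set21.
have tP : t \in [set x; y] by rewrite E set22.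
by move/set2P: xP => [] ?; move/set2P: yP => [] ?; subst; auto;
  move/set2P: zP => [] ?; move/set2P: tP => [] ?; subst; auto.
Qed.

Section Edges.
Variable F : sgraph.

Lemma edgesP (e : {set F}) :
  reflect (exists x y, adj x y /\ e = [set x; y]) (e \in edges F).
Proof.
rewrite inE; apply: (iffP existsP) => [[x /existsP[y /andP[xy /eqP->]]]|].
  by exists x, y.
by move=> [x [y [xy ->]]]; exists x; apply/existsP; exists y; rewrite xy eqxx.
Qed.

Lemma adj_neq (x y : F) : adj x y -> x != y.
Proof. by apply: contraTneq => ->; rewrite adj_irrefl. Qed.

Lemma gsize_param (I : finType) (p : I -> {set F}) :
  injective p -> (forall i, p i \in edges F) ->
  (forall x y, adj x y -> exists i, p i = [set x; y]) -> gsize F = #|I|.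
Proof.
move=> p_inj p_edge p_surj; rewrite -(card_imset _ p_inj).
apply: eq_card => e; apply/idP/imsetP => [/edgesP[x [y [/p_surj[i <-] ->]]]|[i _ ->]//].
by exists i.
Qed.

Definition edges_avoiding (v : F) := [set e in edges F | v \notin e].

Lemma card_edges_avoiding (v x y : F) :
  adj v x -> adj v y -> x != y -> #|edges_avoiding v| + 2 <= gsize F.
Proof.
move=> vx vy xy; rewrite /gsize -(cardsID [set e : {set F} | v \in e] (edges F)) [leqLHS]addnC.
have -> : edges_avoiding v = edges F :\: [set e : {set F} | v \in e].
  by apply/setP => e; rewrite !inE andbC.
rewrite leq_add2r.
have ne : [set v; x] != [set v; y].
  apply/eqP => /set2_eqP[[_ /eqP]|[vy' _]]; first by rewrite (negbTE xy).
  by move: vy; rewrite vy' adj_irrefl.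
have -> : 2 = #|[set [set v; x]; [set v; y]]| by rewrite cards2 ne.
apply/subset_leq_card/subsetP=> e /set2P[]->; rewrite in_setI in_set set21 andbT.
  by apply/edgesP; exists v, x.
by apply/edgesP; exists v, y.
Qed.

End Edges.

(** * Copies of a graph that miss a vertex *)

Definition embedding (H F : sgraph) (f : H -> F) : Prop :=
  injective f /\ forall x y, adj x y -> adj (f x) (f y).

Section EmbeddingAvoiding.
Variables (F H : sgraph) (h : H -> F) (v : F).
Hypothesis h_emb : embedding h.
Hypothesis hv : forall a, h a != v.

Let image_sub : [set h @: (e : {set H}) | e in edges H] \subset edges_avoiding v.
Proof.
case: h_emb => _ h_adj.
apply/subsetP=> _ /imsetP[_ /edgesP[a [b [ab ->]]] ->].
rewrite imsetU1 imset_set1 inE; apply/andP; split.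
  by apply/edgesP; exists (h a), (h b); split=> //; apply: h_adj.
by rewrite !inE ![v == _]eq_sym !(negbTE (hv _)).
Qed.

Let card_image : #|[set h @: (e : {set H}) | e in edges H]| = gsize H.
Proof. by rewrite card_imset //; apply: imset_inj; case: h_emb. Qed.

Lemma gsize_le_edges_avoiding : gsize H <= #|edges_avoiding v|.
Proof. by rewrite -card_image subset_leq_card. Qed.

(** The copy already supplies [gsize H] distinct edges of [F - v]. If there are no more, every edge
    of [F - v] comes from the copy. *)
Lemma embedding_onto_edges (x y : F) :
  #|edges_avoiding v| <= gsize H -> adj x y -> x != v -> y != v ->
  exists a b, [/\ adj a b, x = h a & y = h b].
Proof.
rewrite -card_image => le xy xv yv.
have E : [set h @: (e : {set H}) | e in edges H] = edges_avoiding v.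
  by apply/eqP; rewrite eqEcard image_sub.
have : [set x; y] \in edges_avoiding v.
  rewrite !inE ![v == _]eq_sym (negbTE xv) (negbTE yv) andbT.
  by apply/existsP; exists x; apply/existsP; exists y; rewrite xy eqxx.
rewrite -E => /imsetP[_ /edgesP[a [b [ab ->]]]].
rewrite imsetU1 imset_set1 => /set2_eqP[[-> ->]|[-> ->]]; first by exists a, b.
by exists b, a; rewrite adj_sym.
Qed.

End EmbeddingAvoiding.

(** * Arrowing with a red matching of size two *)

Lemma contains_2K2 (F : sgraph) (x y z t : F) :
  adj x y -> adj z t -> x != z -> x != t -> y != z -> y != t ->
  contains_copy F (copies 2 (complete_graph 2)).
Proof.
move=> xy zt xz xt yz yt.
have xy' := adj_neq xy; have zt' := adj_neq zt.
pose f (u : 'I_2 * 'I_2) := if u.1 == ord0 then (if u.2 == ord0 then x else y)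
  else (if u.2 == ord0 then z else t).
have ord2P (i : 'I_2) : i = ord0 \/ i = ord_max.
  by case: i => [[|[|//]] p]; [left|right]; apply: val_inj.
exists f; split.
  move=> [i j] [k l]; rewrite /f.
  by case: (ord2P i) => ->; case: (ord2P j) => ->; case: (ord2P k) => ->;
    case: (ord2P l) => -> //= /eqP; rewrite ?[z == _]eq_sym ?[t == _]eq_sym
    ?[y == x]eq_sym ?(negbTE xz) ?(negbTE xt) ?(negbTE yz) ?(negbTE yt) ?(negbTE xy')
    ?(negbTE zt').
move=> [i j] [k l] /andP[/= /eqP-> ]; rewrite /complete_adj /f /=.
by case: (ord2P j) => ->; case: (ord2P k) => ->;
    case: (ord2P l) => -> //= _; rewrite // adj_sym.
Qed.

Section MatchingArrows.
Variables F H : sgraph.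

(** When exactly the star at [v] is red, no two red edges are disjoint, so a blue copy exists. Only
    its edges avoid [v]: an isolated vertex of [H] could still be sent to [v]. *)
Lemma arrows_2K2_avoiding (v : F) :
  arrows F (copies 2 (complete_graph 2)) H ->
  exists h : H -> F, embedding h /\
    forall a b, adj a b -> h a != v.
Proof.
move=> /(_ (fun e => v \in e))[[f [f_inj f_adj]]|[h [h_inj h_adj]]].
  have meet (i : 'I_2) : exists j, f (i, j) = v.
    have /f_adj : @adj (copies 2 (complete_graph 2)) (i, ord0) (i, ord_max).
      by rewrite /= /copies_adj /= eqxx.
    move=> /andP[_]; rewrite eqb_id => /set2P[->|->].
      by exists ord0.
    by exists ord_max.
  have [[j fj] [k fk]] := (meet ord0, meet ord_max).
  by have /f_inj := etrans fj (esym fk).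
exists h; split.
  by split=> // x y /h_adj/andP[].
move=> a b /h_adj/andP[_]; rewrite eqbF_neg !inE negb_or => /andP[+ _].
by rewrite eq_sym.
Qed.

(** If one vertex covers all red edges, a copy of [H] missing it is blue. Otherwise a red edge [xy]
    either is disjoint from another red edge or extends at both ends to a red path [q x y p];
    without triangles [p] and [q] differ, so [xq] and [yp] form a red matching. *)
Lemma arrows_2K2_triangle_free (v0 : F) :
  (forall x y z : F, adj x y -> adj y z -> ~~ adj x z) ->
  (forall v : F, exists h : H -> F, embedding h /\ forall a, h a != v) ->
  arrows F (copies 2 (complete_graph 2)) H.
Proof.
move=> tri emb c.
have star v : (forall x y, @adj (color_class c true) x y -> v \in [set x; y]) ->
    contains_copy (color_class c false) H.
  move=> vP; have [h [[h_inj h_adj] hv]] := emb v.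
  exists h; split=> // a b ab; rewrite /= /color_adj h_adj //= eqbF_neg.
  apply/negP => cab; have := vP (h a) (h b).
  rewrite /= /color_adj h_adj // cab => /(_ isT).
  by rewrite !inE ![v == _]eq_sym !(negbTE (hv _)).
case: (boolP [forall v, [exists x, exists y,
    @adj (color_class c true) x y && (v \notin [set x; y])]]); last first.
  rewrite negb_forall => /existsP[v]; rewrite negb_exists => /forallP vP.
  right; apply: (star v) => x y xy; move: (vP x); rewrite negb_exists.
  by move=> /forallP/(_ y); rewrite xy negbK.
move=> /forallP uncovered; left.
have red_avoiding v : exists x y,
    [/\ @adj (color_class c true) x y, x != v & y != v].
  have /existsP[x /existsP[y /andP[xy]]] := uncovered v.
  by rewrite !inE negb_or ![v == _]eq_sym => /andP[]; exists x, y.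
pose red := color_class c true.
(* A red edge [zt] missing [x] is either disjoint from [xy] or attached to it at [y]. *)
have next (x y z t : red) : adj x y -> adj z t -> z != x -> t != x ->
    contains_copy red (copies 2 (complete_graph 2)) \/
    exists2 u : red, adj y u & u != x.
  move=> xy zt zx tx.
  have [yz|yz] := eqVneq y z; first by right; exists t; rewrite // yz.
  have [yt|yt] := eqVneq y t; first by right; exists z; rewrite // yt adj_sym.
  by left; apply: (contains_2K2 xy zt); rewrite // eq_sym.
have [x [y [xy _ _]]] := red_avoiding v0.
have [z [t [zt zx tx]]] := red_avoiding x.
have [w [u [wu wy uy]]] := red_avoiding y.
have [//|[p yp px]] := next _ _ _ _ xy zt zx tx.
have yx : @adj red y x by rewrite adj_sym.
have [//|[q xq qy]] := next _ _ _ _ yx wu wy uy.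
apply: (contains_2K2 xq yp); rewrite // ?[x == p]eq_sym //; first exact: adj_neq xy.
have /andP[xyF _] := xy; have /andP[ypF _] := yp; have /andP[xqF _] := xq.
by apply: contraTneq xqF => ->; apply: tri xyF ypF.
Qed.

End MatchingArrows.

(** * Edges and components of disjoint paths *)

Lemma gsize_copies_path n m : gsize (copies n (path_graph m.+1)) = n * m.
Proof.
pose p (u : 'I_n * 'I_m) : {set copies n (path_graph m.+1)} :=
  [set (u.1, widen_ord (leqnSn m) u.2); (u.1, lift ord0 u.2)].
rewrite (@gsize_param _ _ p); first by rewrite card_prod !card_ord.
- move=> [i j] [k l]; rewrite /p /= => /set2_eqP[[[-> E1] _]|[[_ E1] [_ E2]]].
    by congr (_, _); apply: val_inj.
  by move: E1 E2; rewrite /bump /=; lia.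
- move=> [i j]; apply/edgesP; exists (i, widen_ord (leqnSn m) j), (i, lift ord0 j).
  by rewrite /= /copies_adj /= eqxx /path_adj /= /bump /= add1n eqxx.
move=> [i x] [k y] /andP[/= /eqP<- /orP[]/eqP xy].
  have xm : x < m by rewrite -ltnS xy.
  exists (i, Ordinal xm); congr [set _; _]; congr (_, _); apply: val_inj => //=.
have ym : y < m by rewrite -ltnS xy.
exists (i, Ordinal ym); rewrite setUC.
by congr [set _; _]; congr (_, _); apply: val_inj.
Qed.

Section PathComponent.
Variables (F : sgraph) (n m : nat).
Variables (h : copies n (path_graph m.+2) -> F) (v : F).
Hypothesis h_inj : injective h.
Hypothesis h_onto : forall x y : F, adj x y -> x != v -> y != v ->
  exists a b, [/\ adj a b, x = h a & y = h b].

(** Each edge of [s] is an edge of the image of [h], and consecutive edges share a vertex, so by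
    injectivity of [h] the walk never leaves the copy where its first edge lies. Equal vertex counts
    then make it fill that copy. *)
Lemma path_image_component (s : path_graph m.+2 -> F) :
  embedding s -> (forall j, s j != v) ->
  exists k, codom s =i codom (fun j => h (k, j)).
Proof.
move=> [s_inj s_adj] sv.
have [[k j0] [_ [_ s0 _]]] : exists a b, [/\ adj a b, s ord0 = h a & s (lift ord0 ord0) = h b].
  by apply: h_onto => //; apply: s_adj.
have sub : codom s \subset codom (fun j => h (k, j)).
  apply/subsetP => _ /codomP[[j jm] ->].
  elim: j jm => [|j IH] jm.
    by apply/codomP; exists j0; rewrite -s0; congr s; apply: val_inj.
  have jm' := ltnW jm; have /codomP[j' sj'] := IH jm'.
  have [|||[k1 j1] [[k2 j2] [/andP[/= /eqP k12 _] s1 s2]]] :=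
    @h_onto (s (Ordinal jm')) (s (Ordinal jm)); try exact: sv.
    by apply: s_adj; rewrite /= /path_adj /= eqxx.
  move: s1; rewrite sj' => /h_inj[k1k _].
  by apply/codomP; exists j2; rewrite s2 k1k k12.
exists k; apply/subset_cardP => //.
by rewrite !card_codom // => i j /h_inj[].
Qed.

End PathComponent.

(** * The lower bound *)

Lemma gsize_lower m (F : sgraph) :
  arrows F (copies 2 (complete_graph 2)) (copies 2 (path_graph m.+3)) ->
  2 * m.+3 + (0 < m) <= gsize F.
Proof.
move=> F_arrows.
pose P := path_graph m.+3.
have avoid (v : F) : exists h : copies 2 P -> F,
    embedding h /\ forall a, h a != v.
  have [h [h_emb hv]] := arrows_2K2_avoiding v F_arrows.
  exists h; split=> // [[i j]].
  (* No vertex of the path is isolated: the first has a successor, any other a predecessor. So the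
     whole copy avoids [v]. *)
  have [->|j0] := eqVneq j ord0.
    by apply: (hv (i, ord0) (i, lift ord0 ord0)); rewrite /= /copies_adj /= eqxx.
  have jm : j.-1 < m.+3 by case: j {j0} => j /=; lia.
  apply: (hv (i, j) (i, Ordinal jm)); rewrite /= /copies_adj /= eqxx /path_adj /=.
  by rewrite prednK ?eqxx ?orbT // lt0n.
(* The all-blue coloring gives the copy whose paths are A (index [ord0]) and B (index [ord_max]);
   their second vertices a and b sit at [j1]. *)
have [f [f_inj f_adj]] : exists f : copies 2 P -> F, embedding f.
  have [[f [_ ]]|[f [f_inj f_adj]]] := F_arrows (fun=> false).
    move=> /(_ (ord0, ord0) (ord0, ord_max)).
    by rewrite /= /color_adj andbF /copies_adj /= => /(_ isT).
  by exists f; split=> // x y /f_adj/andP[].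
pose j1 : P := lift ord0 ord0.
pose j2 : P := lift ord0 (lift ord0 ord0).
have deg i : #|edges_avoiding (f (i, j1))| + 2 <= gsize F.
  apply: (@card_edges_avoiding _ _ (f (i, ord0)) (f (i, j2))).
  - by apply: f_adj; rewrite /= /copies_adj /= eqxx.
  - by apply: f_adj; rewrite /= /copies_adj /= eqxx.
  by apply/eqP=> /f_inj.
have le_2m : 2 * m.+3 <= gsize F.
  have [h [h_emb hv]] := avoid (f (ord0, j1)).
  apply: leq_trans (deg ord0); rewrite (_ : 2 * m.+3 = 2 * m.+2 + 2); last by lia.
  by rewrite leq_add2r -gsize_copies_path; apply: gsize_le_edges_avoiding hv.
rewrite leqNgt; apply/negP => lt.
(* The extra edge is claimed only for [0 < m], that is, for paths on at least four vertices. *)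
have [m0 F_size] : 0 < m /\ gsize F = 2 * m.+3 by move: lt; case: (ltnP 0 m); lia.
(* Two edges are lost at [f (i, j1)], so the remaining ones are no more than those of the copy. *)
have delete i : exists h : copies 2 P -> F, [/\ injective h,
    forall x y, adj x y -> adj (h x) (h y), forall a, h a != f (i, j1) &
    forall x y, adj x y -> x != f (i, j1) -> y != f (i, j1) ->
      exists a b, [/\ adj a b, x = h a & y = h b]].
  have [h [h_emb hv]] := avoid (f (i, j1)).
  exists h; split=> //; try by case: h_emb.
  move=> x y; apply: embedding_onto_edges => //.
  rewrite gsize_copies_path -(leq_add2r 2) (leq_trans (deg i)) // F_size; lia.
have [h [h_inj h_adj ha h_onto]] := delete ord0.
have [g [g_inj g_adj gb g_onto]] := delete ord_max.
have path_of (r : copies 2 P -> F) : injective r ->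
    (forall x y, adj x y -> adj (r x) (r y)) -> forall k, embedding (fun j => r (k, j)).
  move=> r_inj r_adj k; split=> [x y /r_inj[]//|x y xy].
  by apply: r_adj; rewrite /= /copies_adj /= eqxx.
have neq j j' : f (ord0, j) != f (ord_max, j') by apply/eqP => /f_inj.
have [j|kB hB] := path_image_component h_inj h_onto (path_of _ f_inj f_adj ord_max).
  by rewrite eq_sym.
have [j|kA gA] := path_image_component g_inj g_onto (path_of _ f_inj f_adj ord0).
  by [].
(* The third and fourth vertices of A span an edge that survives the deletion of a; [kC] is the
   component of F - a containing it. *)
pose a3 : P := @Ordinal m.+3 3 m0.
have [[kC c] [_ [_ hC _]]] : exists a b,
    [/\ adj a b, f (ord0, j2) = h a & f (ord0, a3) = h b].
  apply: h_onto; first by exact: f_adj.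
    by apply/eqP => /f_inj.
  by apply/eqP => /f_inj.
have kCB : kC != kB.
  apply/eqP => kCB; have : h (kC, c) \in codom (fun j => h (kB, j)).
    by rewrite kCB; apply: codom_f.
  by rewrite -hB -hC => /codomP[j /eqP]; rewrite (negbTE (neq _ _)).
(* The path C avoids b, because b lies on the other component [kB]; hence C is also a path of F -
   b. *)
have [j|kD gD] := path_image_component g_inj g_onto (path_of _ h_inj h_adj kC).
  have : f (ord_max, j1) \in codom (fun j => h (kB, j)).
    by rewrite -hB; apply: (codom_f (fun j => f (ord_max, j))).
  by move=> /codomP[j' ->]; apply: contraNneq kCB => /h_inj[->].
have kAD : kA = kD.
  have : f (ord0, j2) \in codom (fun j => g (kA, j)).
    by rewrite -gA; apply: (codom_f (fun j => f (ord0, j))).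
  have : f (ord0, j2) \in codom (fun j => g (kD, j)).
    by rewrite -gD hC; apply: (codom_f (fun j => h (kC, j))).
  by move=> /codomP[x ->] /codomP[y /g_inj[->]].
have : f (ord0, j1) \in codom (fun j => h (kC, j)).
  by rewrite gD -kAD -gA; apply: (codom_f (fun j => f (ord0, j))).
by move=> /codomP[x /eqP]; rewrite eq_sym (negbTE (ha _)).
Qed.

(** * The upper bound: disjoint paths and cycles *)

Lemma arrows_copies_path n m :
  0 < m ->
  arrows (copies n.+1 (path_graph m)) (copies 2 (complete_graph 2))
    (copies n (path_graph m)).
Proof.
move=> m0; apply: (@arrows_2K2_triangle_free (copies n.+1 (path_graph m)) _ (ord0, Ordinal m0)).
  move=> [i x] [j y] [k z]; rewrite /= /copies_adj /= /path_adj.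
  move=> /andP[_ xy] /andP[_ yz]; rewrite negb_and; apply/orP; right.
  by move: xy yz; lia.
(* Deleting a vertex spoils only its own copy [k]; [lift k] enumerates the others. *)
move=> [k x]; exists (fun u => (lift k u.1, u.2)); split.
  split=> [[i y] [j z] E|[i y] [j z] /andP[/= /eqP-> yz]].
    by have /lift_inj /= -> := congr1 fst E; have /= -> := congr1 snd E.
  by rewrite /= /copies_adj /= eqxx.
by move=> [i y]; apply/eqP => -[/eqP]; rewrite eq_sym (negbTE (neq_lift _ _)).
Qed.

Section Cycle.
Variable n : nat.

(** With at least three vertices, the edges from [x] to [ordS x] are pairwise distinct. *)
Definition cycle_adj : rel 'I_n.+3 :=
  fun x y => (y == ordS x) || (x == ordS y).

Fact cycle_adj_sym : symmetric cycle_adj.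
Proof. by move=> x y; rewrite /cycle_adj orbC. Qed.

Lemma val_ordS (x : 'I_n.+3) : ordS x = (if x == n.+2 :> nat then 0 else x.+1) :> nat.
Proof.
rewrite /=; case: eqP => [->|ne]; first by rewrite modnn.
by rewrite modn_small //; have := ltn_ord x; lia.
Qed.

Lemma cycle_adjE (x y : 'I_n.+3) : cycle_adj x y =
  [|| y == x.+1 :> nat, x == y.+1 :> nat, (x == n.+2 :> nat) && (y == 0 :> nat) |
      (y == n.+2 :> nat) && (x == 0 :> nat)].
Proof.
have E (u w : 'I_n.+3) : (u == w) = (u == w :> nat) by [].
rewrite /cycle_adj !E !val_ordS.
by have := ltn_ord x; have := ltn_ord y; do 2 case: ifP; lia.
Qed.

Fact cycle_adj_irrefl : irreflexive cycle_adj.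
Proof. by move=> x; rewrite cycle_adjE; lia. Qed.

Definition cycle_graph : sgraph := SGraph cycle_adj_sym cycle_adj_irrefl.

Lemma gsize_cycle : gsize cycle_graph = n.+3.
Proof.
rewrite (@gsize_param _ _ (fun x : 'I_n.+3 => [set x; ordS x] : {set cycle_graph})).
- exact: card_ord.
- move=> x y /set2_eqP[[]//|[E1 E2]]; apply: val_inj => /=.
  have := congr1 (@nat_of_ord _) E1; have := congr1 (@nat_of_ord _) E2.
  by rewrite !val_ordS; do 2 case: eqP; lia.
- by move=> x; apply/edgesP; exists x, (ordS x); rewrite /= /cycle_adj eqxx.
move=> x y /orP[]/eqP->; first by exists x.
by exists y; rewrite setUC.
Qed.

End Cycle.

Lemma arrows_cycle m :
  arrows (cycle_graph (2 * m).+2) (copies 2 (complete_graph 2))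
    (copies 2 (path_graph m.+2)).
Proof.
apply: (@arrows_2K2_triangle_free (cycle_graph (2 * m).+2) _ ord0).
  by move=> x y z /=; rewrite !cycle_adjE; lia.
move=> v.
(* Here [N] is [2 * m.+2 + 1]. Going round from [v], the remaining vertices form one path, cut into
   two halves of [m.+2] vertices; [a] gives positions before reduction modulo [N], and [r] reduces
   them. *)
pose N := (2 * m).+2.+3.
have vN : v < N by [].
pose a (u : 'I_2 * 'I_m.+2) := v.+1 + u.1 * m.+2 + u.2.
have aP (u : 'I_2 * 'I_m.+2) : v < a u < v + N.
  by rewrite /a /N; case: u => [[[|[|//]] ?] [j ?]] /=; lia.
have a_inj : injective a.
  move=> [[i i2] [j jm]] [[k k2] [l lm]]; rewrite /a /= => E.
  have ik : i = k by case: i k i2 k2 E => [|[|//]] [|[|//]] //= _ _; lia.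
  by subst k; have jl : j = l by [lia]; subst l; congr (_, _); apply: val_inj.
pose r u := if a u < N then a u else a u - N.
have rN u : r u < N by rewrite /r; have := aP u; case: ifP; lia.
exists (fun u => Ordinal (rN u)); split; first split.
- move=> u w /(congr1 val) /=; rewrite /r => E; apply: a_inj.
  by move: E; have := aP u; have := aP w; do 2 case: ifP; lia.
- move=> u w /andP[/eqP uw1 uw2].
  have : a w = (a u).+1 \/ a u = (a w).+1.
    by move: uw2; rewrite /a uw1 /= /path_adj; lia.
  by rewrite /= cycle_adjE /= /r; have := aP u; have := aP w;
    rewrite /N; do 2 case: ifP; lia.
by move=> u; rewrite -val_eqE /= /r; have := aP u; case: ifP; lia.
Qed.

(** * Matching the two bounds *)

Theorem proposition3p3 (m : nat) (hm : 3 <= m) :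
  is_size_ramsey_number (copies 2 (complete_graph 2)) (copies 2 (path_graph m))
    (minn (2 * m + 1) (3 * m - 3)) /\
  minn (2 * m + 1) (3 * m - 3) = (if m == 3 then 6 else 2 * m + 1).
Proof.
case: m hm => [|[|[|m]]] // _.
have E : minn (2 * m.+3 + 1) (3 * m.+3 - 3) = 2 * m.+3 + (0 < m) by lia.
split; last by rewrite E; case: m {E}.
rewrite E; split; last exact: gsize_lower.
(* For three vertices, [3P_3] has 6 edges, one fewer than the cycle; from four on, the cycle on
   [2m+1] vertices is optimal. *)
case: m {E} => [|m].
  by exists (copies 3 (path_graph 3)); rewrite gsize_copies_path; split=> //;
    apply: arrows_copies_path.
exists (cycle_graph (2 * m.+2).+2); split; first exact: arrows_cycle.
by rewrite gsize_cycle; lia.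
Qed.
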